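(* Let $p$ be a prime and let $F$ be a non-abelian free group of finite rank. Then $\mathrm{Comm}_p(F)=\mathrm{AComm}_p(F)$, that is, $\mathrm{Comm}_p(F)$ is generated by the subgroups $\mathrm{Aut}(H)$, where $H$ ranges over all $p$-open subgroups of $F$.
   Context: A subgroup of $F$ is $p$-open if it is open in the pro-$p$ topology of $F$, i.e. if it contains a normal subgroup of $F$ of finite $p$-power index. $\mathrm{Comm}_p(F)$ is the group of equivalence classes $[f]$ of isomorphisms $f:U\to V$ between $p$-open subgroups of $F$, where two such isomorphisms are equivalent if they coincide on some $p$-open subgroup of $F$, with product $[f_1][f_2]=[f_1\circ f_2]$ (for $f_i:U_i\to V_i$, the composition is defined on $f_2^{-1}(V_2\cap U_1)$). For a $p$-open subgroup $H$ of $F$, the canonical homomorphism $\mathrm{Aut}(H)\to\mathrm{Comm}_p(F)$, $\phi\mapsto[\phi]$, is injective, and $\mathrm{Aut}(H)$ is identified with its image. $\mathrm{AComm}_p(F)$ is the subgroup of $\mathrm{Comm}_p(F)$ generated by the subgroups $\mathrm{Aut}(H)$, where $H$ ranges over all $p$-open subgroups of $F$. *)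

(* Defs.v *)
From HB Require Import structures.
From mathcomp Require Import all_boot all_order all_fingroup all_solvable.
From mathcomp Require Import generic_quotient.
From mathcomp Require Import boolp classical_sets functions cardinality.

Set Implicit Arguments.
Unset Strict Implicit.
Unset Printing Implicit Defensive.

Local Open Scope classical_set_scope.
Local Open Scope card_scope.
Local Open Scope group_scope.
Local Open Scope quotient_scope.

Section Groups.
Variable G : groupType.
Implicit Types (H N : set G).

Definition subgroup H : Prop :=
  H 1 /\ forall x y, H x -> H y -> H (x * y^-1).

Definition normal_subgroup N : Prop :=
  subgroup N /\ forall x g, N x -> N (x ^ g).

Definition left_coset N (g : G) : set G := [set g * x | x in N].

Definition has_index N (n : nat) : Prop := range (left_coset N) #= `I_n.

(* [p.-nat n] says that all prime divisors of n are equal to p; for p prime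
   this means that n is a power of p.  With this form the p-open subgroups are
   closed under intersection without any assumption on p. *)
Definition p_open (p : nat) H : Prop :=
  subgroup H /\
  exists (N : set G) (n : nat),
    [/\ normal_subgroup N, N `<=` H, has_index N n & p.-nat n].

Definition free_basis (I : Type) (b : I -> G) : Prop :=
  forall (K : groupType) (h : I -> K),
    exists! phi : G -> K,
      {morph phi : x y / x * y} /\ forall i, phi (b i) = h i.

Definition free_of_finite_rank : Prop :=
  exists (n : nat) (b : 'I_n -> G), free_basis b.

Definition abelian_group : Prop := forall x y : G, commute x y.

End Groups.
Arguments free_of_finite_rank G : clear implicits.
Arguments abelian_group G : clear implicits.

Section SubgroupTheory.
Variable G : groupType.
Implicit Types (H N A B : set G).

Lemma subgroup1 H : subgroup H -> H 1. Proof. by case. Qed.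

Lemma subgroupV H x : subgroup H -> H x -> H x^-1.
Proof. by move=> [H1 Hd] Hx; rewrite -[x^-1]mul1g; exact: Hd. Qed.

Lemma subgroupM H x y : subgroup H -> H x -> H y -> H (x * y).
Proof.
move=> sH Hx Hy; rewrite -[y]invgK; apply: (sH.2) => //; exact: subgroupV.
Qed.

Lemma subgroupX H x n : subgroup H -> H x -> H (x ^+ n).
Proof.
move=> sH Hx; elim: n => [|n IH]; first by rewrite expg0; exact: subgroup1.
by rewrite expgS; exact: subgroupM.
Qed.

Lemma subgroupT : subgroup [set: G]. Proof. by []. Qed.

Lemma subgroupI A B : subgroup A -> subgroup B -> subgroup (A `&` B).
Proof.
move=> sA sB; split; first by split; exact: subgroup1.
by move=> x y [Ax Bx] [Ay By]; split; [apply: sA.2|apply: sB.2].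
Qed.

End SubgroupTheory.

Section MorphOn.
Variables (G K : groupType) (A : set G) (f : G -> K).
Hypothesis sA : subgroup A.
Hypothesis fM : forall x y, A x -> A y -> f (x * y) = f x * f y.

Lemma morph_on1 : f 1 = 1.
Proof.
apply: (mulgI (f 1)); rewrite -fM ?mulg1 //; exact: subgroup1.
Qed.

Lemma morph_onV x : A x -> f x^-1 = (f x)^-1.
Proof.
move=> Ax; apply: (mulgI (f x)); rewrite -fM ?mulgV ?morph_on1 //.
exact: subgroupV.
Qed.

Lemma morph_onX x n : A x -> f (x ^+ n) = f x ^+ n.
Proof.
move=> Ax; elim: n => [|n IH]; first by rewrite !expg0 morph_on1.
by rewrite !expgS fM ?IH //; exact: subgroupX.
Qed.

Lemma subgroup_preim (B : set K) : subgroup B -> subgroup (A `&` f @^-1` B).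
Proof.
move=> sB; split.
  by split; [exact: subgroup1|rewrite /= morph_on1; exact: subgroup1].
move=> x y [Ax /= Bx] [Ay /= By]; split; first exact: sA.2.
rewrite /= fM ?morph_onV //; first exact: sB.2.
exact: subgroupV.
Qed.

End MorphOn.

(* N contains the kernel of a homomorphism from A to a finite group whose image
   has exponent dividing a power of p. *)
Definition p_ker (G : groupType) (p : nat) (A N : set G) : Prop :=
  exists (gT : finGroupType) (phi : G -> gT) (m : nat),
    [/\ forall x y, A x -> A y -> phi (x * y) = phi x * phi y,
        p.-nat m,
        forall x, A x -> phi (x ^+ m) = 1
      & forall x, A x -> phi x = 1 -> N x].

Section PKer.
Variables (G : groupType) (p : nat).
Implicit Types (H N A B : set G).

Lemma p_kerS A B N N' : B `<=` A -> N `<=` N' -> p_ker p A N -> p_ker p B N'.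
Proof.
move=> BA NN [gT [phi [m [phiM pm phim kN]]]]; exists gT, phi, m; split=> //.
- by move=> x y /BA Ax /BA Ay; exact: phiM.
- by move=> x /BA; exact: phim.
- by move=> x /BA Ax e; apply: NN; exact: kN.
Qed.

Lemma p_kerI A N1 N2 : subgroup A ->
  p_ker p A N1 -> p_ker p A N2 -> p_ker p A (N1 `&` N2).
Proof.
move=> sA [gT1 [phi1 [m1 [M1 pm1 e1 k1]]]] [gT2 [phi2 [m2 [M2 pm2 e2 k2]]]].
exists (gT1 * gT2)%type, (fun x => (phi1 x, phi2 x)), (m1 * m2)%N; split.
- by move=> x y Ax Ay; rewrite M1 // M2.
- by rewrite pnatM pm1.
- move=> x Ax; congr (_, _).
    by rewrite expgM (morph_onX sA M1) ?e1 ?expg1n //; exact: subgroupX.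
  by rewrite mulnC expgM (morph_onX sA M2) ?e2 ?expg1n //; exact: subgroupX.
- by move=> x Ax [x1 x2]; split; [exact: k1|exact: k2].
Qed.

Lemma has_index_p_ker N n : normal_subgroup N -> has_index N n -> p.-nat n ->
  p_ker p [set: G] N.
Proof.
move=> [sN nN] iN pn.
have cosE x y : left_coset N x = left_coset N y <-> N (x^-1 * y).
  split=> [e|Nxy].
    have : left_coset N y y by exists 1; [exact: subgroup1|rewrite mulg1].
    by rewrite -e => -[z Nz <-]; rewrite mulKg.
  apply/seteqP; split=> _ [z Nz <-].
    exists ((x^-1 * y)^-1 * z); first by apply: subgroupM => //; exact: subgroupV.
    by rewrite invgM invgK !mulgA mulgV mul1g.
  exists ((x^-1 * y) * z); first exact: subgroupM.
  by rewrite !mulgA mulgV mul1g.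
have /card_esym/card_set_bijP [f [fS fI fJ]] := iN.
have n_gt0 : (0 < n)%N.
  have /fJ[k k0 _] : range (left_coset N) (left_coset N 1) by exists 1.
  exact: leq_ltn_trans (leq0n k) k0.
have cP x : exists i : 'I_n, f i = left_coset N x.
  have /fJ[k kn e] : range (left_coset N) (left_coset N x) by exists x.
  by exists (Ordinal kn).
have tP (i : 'I_n) : exists x, left_coset N x = f i.
  by have /fS[x _ e] : `I_n i := ltn_ord i; exists x.
pose c x := projT1 (cid (cP x)); have cE x : f (c x) = left_coset N x.
  by rewrite /c; case: cid.
pose t i := projT1 (cid (tP i)); have tE i : left_coset N (t i) = f i.
  by rewrite /t; case: cid.
have cN x y : c x = c y <-> N (x^-1 * y).
  rewrite -cosE -!cE; split=> [->//|e]; apply: val_inj.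
  by apply: fI => //; apply/mem_set; exact: ltn_ord.
have ct i : c (t i) = i.
  by apply: val_inj; apply: fI; rewrite ?cE ?tE //; apply/mem_set; exact: ltn_ord.
have tc x : N ((t (c x))^-1 * x) by apply/cN; rewrite ct.
have cM g0 x y : c x = c y -> c (g0 * x) = c (g0 * y).
  by move/cN => h; apply/cN; rewrite invgM mulgA -[_ * g0^-1 * g0]mulgA mulVg mulg1.
pose a (x : G) (i : 'I_n) := c (x * t i).
have aI x : injective (a x).
  move=> i j /(@cM x^-1); rewrite !mulgA mulVg !mul1g.
  by rewrite !ct.
pose phi x : 'S_n := perm (@aI x^-1).
have phiE x i : phi x i = c (x^-1 * t i) by rewrite permE.
have phiM x y : phi (x * y) = phi x * phi y.
  apply/permP => i; rewrite permM !phiE invgM -mulgA.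
  by apply: cM; rewrite ct.
have phic x : phi x (c 1) = c x^-1.
  by rewrite phiE -{2}[x^-1]mulg1; apply: cM; rewrite ct.
have phi1 x : phi x = 1 <-> N x.
  split=> [e|Nx].
    by have := phic x; rewrite e perm1 => /esym/cN; rewrite invgK mulg1.
  apply/permP => i; rewrite phiE perm1 -[RHS]ct; apply/cN.
  by rewrite invgM invgK -mulgA; exact: nN.
pose I := [set s : 'S_n | `[< exists x, phi x = s >]]%SET.
have inI s : reflect (exists x, phi x = s) (s \in I).
  by rewrite finset.in_set; exact: asboolP.
have phi_1 : phi 1 = 1 by apply/phi1; exact: subgroup1.
have gI : group_set I.
  apply/group_setP; split; first by apply/inI; exists 1.
  move=> s1 s2 /inI[x <-] /inI[y <-].
  by apply/inI; exists (x * y).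
have cI : #|I| = n.
  rewrite -[RHS]card_ord -cardsT.
  have -> : [set: 'I_n]%SET = [set (s : 'S_n) (c 1) | s in I]%SET.
    apply/esym/setP => i; rewrite inE; apply/imsetP.
    exists (phi (t i)^-1); first by apply/inI; eexists.
    by rewrite phic invgK ct.
  rewrite card_in_imset // => s1 s2 /inI[x <-] /inI[y <-].
  rewrite !phic => /cN; rewrite invgK => /phi1 e.
  by rewrite -[x](mulgVK y) phiM e mul1g.
exists 'S_n, phi, n; split=> //.
- move=> x _; rewrite (morph_onX (subgroupT G)) //.
  have /order_dvdG : phi x \in Group gI by apply/inI; exists x.
  by rewrite [#|_|]cI order_dvdn => /eqP.
- by move=> x _ /phi1.
Qed.

Lemma p_ker_index N : p_ker p [set: G] N ->
  exists (N' : set G) (n : nat),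
    [/\ normal_subgroup N', N' `<=` N, has_index N' n & p.-nat n].
Proof.
move=> [gT [phi [m [phiM pm phim kN]]]].
have phiM' x y : phi (x * y) = phi x * phi y by exact: phiM.
have phi1 := morph_on1 (subgroupT G) phiM.
have phiV x : phi x^-1 = (phi x)^-1 by exact: (morph_onV (subgroupT G) phiM).
pose I := [set s : gT | `[< exists x, phi x = s >]]%SET.
have inI s : reflect (exists x, phi x = s) (s \in I).
  by rewrite finset.in_set; exact: asboolP.
have gI : group_set I.
  apply/group_setP; split; first by apply/inI; exists 1.
  move=> s1 s2 /inI[x <-] /inI[y <-].
  by apply/inI; exists (x * y).
exists (phi @^-1` [set 1]), #|I|; split.
- split; first split=> //=.
    by move=> x y /= x1 y1; rewrite phiM' phiV x1 y1 invg1 mulg1.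
  by move=> x g /= x1; rewrite /conjg !phiM' phiV x1 mul1g mulVg.
- by move=> x /= x1; exact: kN.
- rewrite /has_index; pose K (y : gT) := phi @^-1` [set y].
  have -> : range (left_coset (phi @^-1` [set 1])) = K @` [set` I].
    have cE x : left_coset (phi @^-1` [set 1]) x = K (phi x).
      apply/seteqP; split=> [_ [z /= z1 <-]|z /= e].
        by rewrite /K /= phiM' z1 mulg1.
      exists (x^-1 * z); first by rewrite /= phiM' phiV e mulVg.
      by rewrite mulgA mulgV mul1g.
    apply/seteqP; split=> [_ [x _ <-]|_ [y /= yI <-]].
      exists (phi x); last by rewrite cE.
      by apply/inI; exists x.
    by move: yI => /inI[x <-]; exists x.
  have KI : {in [set` I] &, injective K}.
    move=> y1 y2; rewrite in_setE => /inI[x1 <-] _ e.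
    by have : K (phi x1) x1 by []; rewrite e.
  apply: (card_eq_trans (inj_card_eq KI)).
  have -> : [set` I] = enum_val @` [set: 'I_#|I|].
    apply/seteqP; split=> [y /= yI|_ [i _ <-]]; last exact: enum_valP.
    by exists (enum_rank_in yI y); last exact: enum_rankK_in.
  apply: (card_eq_trans (inj_card_eq (in2W enum_val_inj))).
  by rewrite card_eq_sym; exact: card_II.
- have : p.-group (Group gI); last by [].
  apply/pgroupP => q qp /(Cauchy qp)[s] + ; move=> /inI[x <-] oq.
  have : phi x ^+ m = 1.
    by rewrite -(morph_onX (subgroupT G) phiM) //; exact: phim.
  move/eqP; rewrite -order_dvdn oq => qm.
  by have /andP[m0 _] := pm; apply: (pnatPpi pm); rewrite mem_primes qp m0.
Qed.

Lemma p_openP H : p_open p H <-> subgroup H /\ p_ker p [set: G] H.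
Proof.
split=> [[sH [N [n [nN NH iN pn]]]]|[sH /p_ker_index]].
  split=> //; apply: (p_kerS (@subset_refl _ _) NH).
  exact: has_index_p_ker iN pn.
by [].
Qed.

Lemma p_open_subgroup H : p_open p H -> subgroup H. Proof. by case. Qed.

Lemma p_openT : p_open p [set: G].
Proof.
apply/p_openP; split=> //; exists 'S_0, (fun=> 1), 1%N.
by split=> // *; rewrite mulg1.
Qed.

Lemma p_openI A B : p_open p A -> p_open p B -> p_open p (A `&` B).
Proof.
move=> /p_openP[sA kA] /p_openP[sB kB]; apply/p_openP.
by split; [exact: subgroupI|exact: p_kerI].
Qed.

(* Kaloujnine-Krasner embedding of an extension into a wreath product, which
   is viewed as a permutation group. *)
Lemma p_ker_trans M N :
  p_ker p [set: G] M -> p_ker p M N -> p_ker p [set: G] N.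
Proof.
move=> [P [phi [m1 [phiM' pm1 phim kM]]]] [Q [psi [m2 [psiM' pm2 psim kN]]]].
have phiM x y : phi (x * y) = phi x * phi y by exact: phiM'.
have phi1 := morph_on1 (subgroupT G) phiM'.
have phiV x : phi x^-1 = (phi x)^-1 by exact: (morph_onV (subgroupT G) phiM').
pose K := [set x | phi x = 1].
have KM : K `<=` M by move=> x; exact: kM.
have sK : subgroup K.
  by split=> // x y; rewrite /K /= phiM phiV => -> ->; rewrite invg1 mulg1.
have psiM x y : K x -> K y -> psi (x * y) = psi x * psi y.
  by move=> /KM Mx /KM My; exact: psiM'.
have psi1 := morph_on1 sK psiM.
pose im a := exists x, phi x = a.
have sP a : exists x, (im a -> phi x = a) /\ (a = 1 -> x = 1).
  have [->|a1] := pselect (a = 1); first by exists 1; split.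
  have [[x xa]|na] := pselect (im a); first by exists x; split.
  by exists 1; split.
pose s a := projT1 (cid (sP a)).
have sE a : im a -> phi (s a) = a by rewrite /s; case: cid => ? [].
have s1 : s 1 = 1 by rewrite /s; case: cid => x [? h] /=; exact: h.
have imM g a : im a -> im (phi g * a).
  by move=> [x <-]; exists (g * x); rewrite phiM.
pose d g a := (s (phi g * a))^-1 * (g * s a).
have Kd g a : im a -> K (d g a).
  by move=> ia; rewrite /K /d /= !phiM phiV !sE ?mulVg //; exact: imM.
have dM g h a : d (g * h) a = d g (phi h * a) * d h a.
  by rewrite /d phiM -!mulgA mulKVg.
pose act g (u : P * Q) : P * Q :=
  if `[< im u.1 >] then (phi g * u.1, psi (d g u.1) * u.2) else u.
have actM g h u : act (g * h) u = act g (act h u).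
  rewrite /act; case: (asboolP (im u.1)) => [iu|niu] /=; last first.
    by rewrite asboolF.
  rewrite asboolT; last exact: imM.
  rewrite dM psiM; [|by apply: Kd; exact: imM|exact: Kd].
  by rewrite phiM !mulgA.
have act1 u : act 1 u = u.
  rewrite /act; case: asboolP => // _; rewrite /d phi1 !mul1g mulVg psi1 mul1g.
  by case: u.
have actI g : injective (act g).
  by move=> u v /(congr1 (act g^-1)); rewrite -!actM mulVg !act1.
pose rho g : {perm (P * Q)} := perm (@actI g^-1).
have rhoM x y : rho (x * y) = rho x * rho y.
  by apply/permP => u; rewrite permM !permE invgM actM.
exists {perm (P * Q)}, rho, (m1 * m2)%N; split.
- by [].
- by rewrite pnatM pm1.
- move=> x _; apply/permP => u; rewrite permE perm1.
  rewrite -expVgn; move: (x^-1) => z.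
  rewrite /act; case: asboolP => // iu.
  have Kx y : K (y ^+ m1) by exact: phim.
  have Ky y : K (y ^+ (m1 * m2)) by rewrite expgM; exact: subgroupX.
  rewrite /d (Ky z) mul1g -/(conjg _ _) conjXg expgM.
  by rewrite psim; [rewrite mul1g; case: (u)|exact: KM].
- move=> x _ /permP/(_ (1, 1)); rewrite permE perm1 /act.
  rewrite asboolT /=; last by exists 1.
  rewrite mulg1 => -[x1]; rewrite /d x1 mul1g s1 invg1 mul1g !mulg1 => psix.
  have Kx : K x by rewrite -[x]invgK; apply: subgroupV.
  apply: kN; first exact: KM.
  apply: invg_inj; rewrite invg1 -psix.
  by rewrite (morph_onV sK psiM).
Qed.

End PKer.

Section POpenMorph.
Variables (G : groupType) (p : nat).
Implicit Types (U V W : set G) (f : G -> G).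

Lemma p_open_preim U W f : p_open p U ->
    (forall x y, U x -> U y -> f (x * y) = f x * f y) ->
  p_open p W -> p_open p (U `&` f @^-1` W).
Proof.
move=> /p_openP[sU kU] fM /p_openP[sW kW]; apply/p_openP.
split; first exact: subgroup_preim.
apply: p_kerI => //; apply: p_ker_trans kU _.
move: kW => [gT [phi [m [phiM pm phim kN]]]].
exists gT, (phi \o f), m; split=> //=.
- by move=> x y Ux Uy; rewrite fM // phiM.
- by move=> x Ux; rewrite (morph_onX sU fM) //; exact: phim.
- by move=> x Ux; exact: kN.
Qed.

End POpenMorph.

(* Isomorphisms between p-open subgroups.  Only the restriction of [pfun] to
   [dom] is meaningful. *)
Record piso (p : nat) (F : groupType) := PIso {
  dom : set F;
  cod : set F;
  pfun :> F -> F;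
  dom_open : p_open p dom;
  cod_open : p_open p cod;
  pfun_bij : set_bij dom cod pfun;
  pfunM : forall x y, dom x -> dom y -> pfun (x * y) = pfun x * pfun y
}.

HB.instance Definition _ p F := gen_eqMixin (piso p F).
HB.instance Definition _ p F := gen_choiceMixin (piso p F).

Section PIsoOps.
Variables (p : nat) (F : groupType).
Implicit Types (f g h : piso p F).

Lemma pfun_cod f x : dom f x -> cod f (f x).
Proof. by have [fS _ _] := pfun_bij f; exact: fS. Qed.

Lemma pfun_inj f x y : dom f x -> dom f y -> f x = f y -> x = y.
Proof.
by have [_ fI _] := pfun_bij f => dx dy; apply: fI; exact/mem_set.
Qed.

Lemma id_bij : set_bij [set: F] [set: F] id.
Proof. by split=> // x _; exists x. Qed.

Definition piso_id : piso p F :=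
  @PIso p F setT setT id (p_openT F p) (p_openT F p) id_bij
    (fun _ _ _ _ => erefl).

Definition inv_fun f : F -> F := 'pinv_(fun=> 1) (dom f) f.

Lemma inv_bij f : set_bij (cod f) (dom f) (inv_fun f).
Proof. exact: bijpinv_bij (pfun_bij f). Qed.

Lemma inv_funK f x : dom f x -> inv_fun f (f x) = x.
Proof.
move=> dx; apply: pinvKV; last exact/mem_set.
by have [_ fI _] := pfun_bij f.
Qed.

Lemma inv_funKV f y : cod f y -> f (inv_fun f y) = y.
Proof.
have [_ _ fJ] := pfun_bij f => /fJ[x dx <-].
by rewrite inv_funK.
Qed.

Lemma inv_fun_dom f y : cod f y -> dom f (inv_fun f y).
Proof. by have [fS _ _] := inv_bij f; exact: fS. Qed.

Lemma inv_funM f x y : cod f x -> cod f y ->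
  inv_fun f (x * y) = inv_fun f x * inv_fun f y.
Proof.
move=> cx cy.
have sd := p_open_subgroup (dom_open f); have sc := p_open_subgroup (cod_open f).
have dx := inv_fun_dom cx; have dy := inv_fun_dom cy.
apply: (@pfun_inj f); last by rewrite pfunM // !inv_funKV //; exact: subgroupM.
  by apply: inv_fun_dom; exact: subgroupM.
exact: subgroupM.
Qed.

Definition piso_inv f : piso p F :=
  PIso (cod_open f) (dom_open f) (inv_bij f) (@inv_funM f).

Lemma p_open_image f W : W `<=` dom f -> p_open p W -> p_open p (f @` W).
Proof.
move=> Wd oW.
have -> : f @` W = cod f `&` inv_fun f @^-1` W.
  apply/seteqP; split=> [_ [x Wx <-]|y [cy Wy]].
    split; first exact/pfun_cod/Wd.
    by rewrite /= inv_funK; last exact: Wd.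
  by exists (inv_fun f y) => //; exact: inv_funKV.
exact: p_open_preim (cod_open f) (@inv_funM f) oW.
Qed.

Definition comp_dom f g := dom g `&` g @^-1` (cod g `&` dom f).
Definition comp_cod f g := f @` (cod g `&` dom f).

Lemma comp_dom_open f g : p_open p (comp_dom f g).
Proof.
apply: p_open_preim (dom_open g) (@pfunM _ _ g) _.
exact: p_openI (cod_open g) (dom_open f).
Qed.

Lemma comp_cod_open f g : p_open p (comp_cod f g).
Proof.
apply: p_open_image; first by move=> x [].
exact: p_openI (cod_open g) (dom_open f).
Qed.

Lemma comp_bij f g : set_bij (comp_dom f g) (comp_cod f g) (f \o g).
Proof.
split.
- by move=> x [dx [cx fx]]; exists (g x).
- move=> x y /set_mem[dx [_ fx]] /set_mem[dy [_ fy]] /= e.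
  by apply: (pfun_inj dx dy); exact: (pfun_inj fx fy).
- move=> _ [y [cy fy] <-]; exists (inv_fun g y); last by rewrite /= inv_funKV.
  by split; [exact: inv_fun_dom|rewrite /= inv_funKV].
Qed.

Lemma comp_funM f g x y : comp_dom f g x -> comp_dom f g y ->
  (f \o g) (x * y) = (f \o g) x * (f \o g) y.
Proof. by move=> [dx [_ fx]] [dy [_ fy]] /=; rewrite !pfunM. Qed.

Definition piso_comp f g : piso p F :=
  PIso (comp_dom_open f g) (comp_cod_open f g) (comp_bij f g) (@comp_funM f g).

Definition piso_eqv f g : Prop :=
  exists W : set F,
    [/\ p_open p W, W `<=` dom f `&` dom g & forall x, W x -> f x = g x].

Definition piso_eqvb f g : bool := `[< piso_eqv f g >].

Lemma piso_eqv_refl : reflexive piso_eqvb.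
Proof.
by move=> f; apply/asboolP; exists (dom f); split=> //; exact: dom_open.
Qed.

Lemma piso_eqv_symm f g : piso_eqv f g -> piso_eqv g f.
Proof.
move=> [W [oW Wd e]]; exists W; split=> //; first by rewrite setIC.
by move=> x Wx; rewrite e.
Qed.

Lemma piso_eqv_sym : symmetric piso_eqvb.
Proof.
by move=> f g; apply/asboolP/asboolP; exact: piso_eqv_symm.
Qed.

Lemma piso_eqv_trans : transitive piso_eqvb.
Proof.
move=> g f h /asboolP[W [oW Wd e]] /asboolP[W' [oW' Wd' e']].
apply/asboolP; exists (W `&` W'); split; first exact: p_openI.
  by move=> x [/Wd[? _] /Wd'[_ ?]].
by move=> x [Wx W'x]; rewrite e ?e'.
Qed.

Canonical piso_eqv_rel :=
  EquivRel piso_eqvb piso_eqv_refl piso_eqv_sym piso_eqv_trans.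

End PIsoOps.

Definition Comm (p : nat) (F : groupType) := {eq_quot (@piso_eqv_rel p F)}.
HB.instance Definition _ p F := Choice.on (Comm p F).
HB.instance Definition _ p F := EqQuotient.on (Comm p F).

Section CommGroup.
Variables (p : nat) (F : groupType).
Implicit Types (f g h : piso p F).
Local Notation C := (Comm p F).

Definition piso_class f : C := \pi_C f.

Lemma piso_classP f g : piso_class f = piso_class g <-> piso_eqv f g.
Proof. by split=> [/eqmodP/asboolP|?]; last exact/eqmodP/asboolP. Qed.

Lemma piso_class_repr (a : C) : piso_class (repr a) = a.
Proof. exact: reprK. Qed.

Definition comm_mul (a b : C) : C := piso_class (piso_comp (repr a) (repr b)).
Definition comm_one : C := piso_class (piso_id p F).
Definition comm_inv (a : C) : C := piso_class (piso_inv (repr a)).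

Lemma comm_mulE f g :
  comm_mul (piso_class f) (piso_class g) = piso_class (piso_comp f g).
Proof.
have /piso_classP[W [oW Wd e]] := piso_class_repr (piso_class f).
have /piso_classP[W' [oW' Wd' e']] := piso_class_repr (piso_class g).
apply/piso_classP; move: (repr _) (repr _) Wd e Wd' e' => f' g' Wd e Wd' e'.
exists (W' `&` (dom g `&` g @^-1` W)); split.
- exact/p_openI/p_open_preim/oW/pfunM/dom_open.
- move=> x [W'x [dx /= Wx]].
  have [d'x _] := Wd' _ W'x; have [df' df] := Wd _ Wx.
  split; split=> //; split=> //=; rewrite ?e' //; last exact: pfun_cod.
  by rewrite -e' //; exact: pfun_cod.
- by move=> x [W'x [dx /= Wx]]; rewrite e' // e.
Qed.

Lemma comm_invE f : comm_inv (piso_class f) = piso_class (piso_inv f).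
Proof.
have /piso_classP[W [oW Wd e]] := piso_class_repr (piso_class f).
apply/piso_classP; move: (repr _) Wd e => f' Wd e.
exists (f @` W); split.
- by apply: p_open_image => // x /Wd[].
- move=> _ [x Wx <-]; have [d'x dx] := Wd _ Wx.
  by split=> /=; [rewrite -e //|]; exact: pfun_cod.
- move=> _ [x Wx <-]; have [d'x dx] := Wd _ Wx.
  by rewrite /= inv_funK // -e // inv_funK.
Qed.

Lemma comm_ind (P : C -> Prop) : (forall f, P (piso_class f)) -> forall a, P a.
Proof. by move=> h a; rewrite -[a]piso_class_repr. Qed.

Lemma comm_mulA : associative comm_mul.
Proof.
elim/comm_ind => f; elim/comm_ind => g; elim/comm_ind => h; rewrite !comm_mulE.
apply/piso_classP; exists (dom (piso_comp f (piso_comp g h))); split=> //.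
  exact: dom_open.
move=> x /[dup] xd [[xh [ch dg]] /= [cx df]]; split=> //.
by split=> //; split=> //; split=> //; split=> //; exact: pfun_cod.
Qed.

Lemma comm_mul1 : left_id comm_one comm_mul.
Proof.
elim/comm_ind => f; rewrite comm_mulE; apply/piso_classP.
exists (dom f); split=> //; first exact: dom_open.
by move=> x dx; split=> //; split=> //; split=> //; exact: pfun_cod.
Qed.

Lemma comm_mulr1 : right_id comm_one comm_mul.
Proof.
elim/comm_ind => f; rewrite comm_mulE; apply/piso_classP.
by exists (dom f); split=> //; exact: dom_open.
Qed.

Lemma comm_mulV : left_inverse comm_one comm_inv comm_mul.
Proof.
elim/comm_ind => f; rewrite comm_invE comm_mulE; apply/piso_classP.
exists (dom f); split; first exact: dom_open.
  by move=> x dx; split=> //; split=> //; split; exact: pfun_cod.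
by move=> x dx /=; rewrite inv_funK.
Qed.

Lemma comm_mulrV : right_inverse comm_one comm_inv comm_mul.
Proof.
elim/comm_ind => f; rewrite comm_invE comm_mulE; apply/piso_classP.
exists (cod f); split; first exact: cod_open.
  by move=> x cx; split=> //; split=> //; split; exact: inv_fun_dom.
by move=> x cx /=; rewrite inv_funKV.
Qed.

HB.instance Definition _ :=
  isGroup.Build (Comm p F) comm_mulA comm_mul1 comm_mulr1 comm_mulV comm_mulrV.

Lemma piso_classM f g :
  piso_class f * piso_class g = piso_class (piso_comp f g).
Proof. exact: comm_mulE. Qed.

Lemma piso_classV f : (piso_class f)^-1 = piso_class (piso_inv f).
Proof. exact: comm_invE. Qed.

(* The image of Aut(H) in Comm_p(F). *)
Definition AutComm (H : set F) : set (Comm p F) :=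
  [set piso_class f | f in [set f : piso p F | dom f = H /\ cod f = H]].

Definition AComm : set (Comm p F) :=
  smallest (@subgroup (Comm p F)) (\bigcup_(H in [set H | p_open p H]) AutComm H).

End CommGroup.
Arguments AComm p F : clear implicits.

(* Main.v *)
From HB Require Import structures.
From mathcomp Require Import all_boot all_fingroup all_solvable.
From mathcomp Require Import boolp classical_sets functions.
Require Import Defs.

(** A p-open subgroup [U] of [F] is reached from [F] by a chain of subgroups in
    which each one is normal of index [p] in the preceding one, because a proper
    subgroup of a finite p-group lies in a normal subgroup of index [p]
    ([p_open_step_chain]).

    Let [H] be free on finitely many elements, with [K] and [K'] normal of index
    [p] in [H].  Then some automorphism of [H] maps [K] onto [K']
    ([cyclic_step_trans]): Nielsen transformations turn a basis of [H] into one
    in which a single element [t] lies outside [K] ([cyclic_step_adapted]), and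
    likewise for [K'], and an automorphism matches the two bases.  Moreover, [K]
    is again free, on [t ^+ p] and the conjugates of the other basis elements by
    [1, t, .., t ^+ p.-1] ([ker_basisP]); so the rank minus one is multiplied
    by [p].

    By induction on the length, any two chains of the same length from [H] end
    in subgroups [U] and [V] that are related by an isomorphism in [AComm]
    ([AComm_step_chain]): an automorphism of [H] matches the first steps, and the
    induction hypothesis applies inside the common first step.

    Now let [f : U -> V] be an isomorphism between p-open subgroups of [F].  As
    [U] and [V] have the same rank ([basis_on_card]) and the rank of [F] is at
    least two, their chains have the same length.  So [AComm] contains the class
    of some isomorphism [g : U -> V], and [f] differs from [g] by an automorphism
    of [U]. *)

Set Implicit Arguments.
Unset Strict Implicit.
Unset Printing Implicit Defensive.

Local Open Scope classical_set_scope.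
Local Open Scope group_scope.

(** * Bases of subgroups *)

Definition hom_on (G K : groupType) (H : set G) (f : G -> K) : Prop :=
  forall x y, H x -> H y -> f (x * y) = f x * f y.

(** The universal property of [free_basis] for a subgroup, in a form that does
    not mention the group structure of the subgroup: uniqueness of the extension
    is replaced by generation. *)
Definition basis_on (G : groupType) (I : Type) (H : set G) (b : I -> G) : Prop :=
  [/\ forall i, H (b i),
      forall S, subgroup S -> (forall i, S (b i)) -> H `<=` S
    & forall (K : groupType) (h : I -> K),
        exists phi : G -> K, hom_on H phi /\ forall i, phi (b i) = h i].

Section Bases.
Variables (G : groupType) (H : set G).
Hypothesis sH : subgroup H.

Lemma eq_hom_on (I : Type) (b : I -> G) (K : groupType) (f g : G -> K) :
  basis_on H b -> hom_on H f -> hom_on H g -> (forall i, f (b i) = g (b i)) ->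
  forall x, H x -> f x = g x.
Proof.
move=> [Hb genb _] fM gM e.
suff HS : H `<=` H `&` [set x | f x = g x] by move=> x /HS[].
apply: genb => [|i]; last by split.
split; first by split; [exact: sH.1|rewrite /= (morph_on1 sH fM) (morph_on1 sH gM)].
move=> x y [Hx /= ex] [Hy /= ey]; split; first exact: sH.2.
have Hy' := subgroupV sH Hy.
by rewrite /= fM // gM // (morph_onV sH fM) // (morph_onV sH gM) // ex ey.
Qed.

(** The elements whose left multiplication preserves [P] in both directions form
    a subgroup, so that inverses of basis elements need no separate case. *)
Lemma basis_on_ind (I : Type) (b : I -> G) (P : G -> Prop) :
  basis_on H b -> P 1 -> (forall i x, P (b i * x) <-> P x) ->
  forall x, H x -> P x.
Proof.
move=> [_ genb _] P1 Pb.
suff HS : H `<=` [set g | forall x, P (g * x) <-> P x].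
  by move=> x /HS/(_ 1); rewrite mulg1 => ->.
apply: genb => //; split=> [x|x y xS yS z] /=; first by rewrite mul1g.
by rewrite -mulgA xS -yS mulgA mulgV mul1g.
Qed.

Lemma hom_on_mem (I : Type) (b : I -> G) (gT : finGroupType) (f : G -> gT)
    (A : {group gT}) :
  basis_on H b -> hom_on H f -> (forall i, f (b i) \in A) ->
  forall x, H x -> f x \in A.
Proof.
move=> [Hb genb _] fM Ab.
have sA : subgroup [set x | x \in A].
  by split=> /= [|x y Ax Ay]; rewrite ?groupM ?groupV.
suff HS : H `<=` H `&` f @^-1` [set x | x \in A] by move=> x /HS[].
by apply: genb => [|i]; [exact: (subgroup_preim sH fM)|split=> //=].
Qed.

Lemma basis_on_reindex (I I' : Type) (b : I -> G) (s : I' -> I) :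
  bijective s -> basis_on H b -> basis_on H (b \o s).
Proof.
move=> [r sK rK] [Hb genb extb]; split=> /= [i|S sS Sb|K h] //.
  by apply: genb => // i; rewrite -[i]rK.
have [f [fM fb]] := extb K (h \o r).
by exists f; split=> // i; rewrite fb /= sK.
Qed.

(** A Nielsen transformation. *)
Lemma basis_on_mulX (J : Type) (b : option J -> G) (m : J -> nat) :
  basis_on H b ->
  basis_on H (fun i => if i is Some j then b (Some j) * (b None)^-1 ^+ m j
                       else b None).
Proof.
move=> [Hb genb extb]; split=> [[j|] //|S sS Sb|K h].
- by apply: subgroupM => //; apply: subgroupX => //; exact: subgroupV.
- apply: genb => // -[j|]; last exact: (Sb None).
  rewrite -[b _](mulgKV (b None ^+ m j)) -expVgn; apply: subgroupM => //.
    exact: (Sb (Some j)).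
  by apply: subgroupX => //; exact: (Sb None).
- have [f [fM fb]] := extb K (fun i =>
    if i is Some j then h (Some j) * h None ^+ m j else h None).
  exists f; split=> // -[j|]; last by rewrite fb.
  have HV := subgroupV sH (Hb None).
  rewrite fM //; last exact: subgroupX.
  rewrite (morph_onX sH fM) // (morph_onV sH fM) // !fb.
  by rewrite expVgn mulgK.
Qed.

End Bases.

Section SubgroupCarrier.
Variables (G : groupType) (S : set G) (sS : subgroup S).

Definition carrier (_ : subgroup S) := {x : G | S x}.
HB.instance Definition _ := gen_eqMixin (carrier sS).
HB.instance Definition _ := gen_choiceMixin (carrier sS).

Lemma carrier_inj (x y : carrier sS) : sval x = sval y -> x = y.
Proof. by case: x y => [x Sx] [y Sy] /= e; exact: eq_exist. Qed.

Definition carrier_mul (x y : carrier sS) : carrier sS :=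
  exist _ _ (subgroupM sS (svalP x) (svalP y)).
Definition carrier_one : carrier sS := exist _ _ (subgroup1 sS).
Definition carrier_inv (x : carrier sS) : carrier sS :=
  exist _ _ (subgroupV sS (svalP x)).

Lemma carrier_mulA : associative carrier_mul.
Proof. by move=> x y z; apply: carrier_inj; exact: mulgA. Qed.
Lemma carrier_mul1 : left_id carrier_one carrier_mul.
Proof. by move=> x; apply: carrier_inj; exact: mul1g. Qed.
Lemma carrier_mulr1 : right_id carrier_one carrier_mul.
Proof. by move=> x; apply: carrier_inj; exact: mulg1. Qed.
Lemma carrier_mulV : left_inverse carrier_one carrier_inv carrier_mul.
Proof. by move=> x; apply: carrier_inj; exact: mulVg. Qed.
Lemma carrier_mulrV : right_inverse carrier_one carrier_inv carrier_mul.
Proof. by move=> x; apply: carrier_inj; exact: mulgV. Qed.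

HB.instance Definition _ := isGroup.Build (carrier sS)
  carrier_mulA carrier_mul1 carrier_mulr1 carrier_mulV carrier_mulrV.

End SubgroupCarrier.

(** A subgroup [S] that contains the basis is the whole group: the basis
    determines a homomorphism to [S], whose composition with the inclusion of [S]
    is the identity by uniqueness. *)
Lemma free_basis_on (G : groupType) (I : Type) (b : I -> G) :
  free_basis b -> basis_on [set: G] b.
Proof.
move=> free_b; split=> // [S sS Sb x _|K h].
  have [f [[fM fb] _]] := free_b (carrier sS) (fun i => exist _ _ (Sb i)).
  have [u [_ uU]] := free_b G b.
  have uid : u = id by apply: uU.
  have uf : u = (fun x => sval (f x)).
    by apply: uU; split=> [y z|i]; rewrite /= ?fM ?fb.
  by rewrite -[x]/(id x) -uid uf; exact: svalP.
have [f [[fM fb] _]] := free_b K h.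
by exists f; split=> // x y _ _; exact: fM.
Qed.

(** * Kernels of cyclic quotients of free groups *)

(** The monomial group, i.e. the permutational wreath product of [L] by
    [{perm I}]. *)
Definition monomial (I : finType) (L : groupType) :=
  ({ffun I -> L} * {perm I})%type.

Section Monomial.
Variables (I : finType) (L : groupType).
Local Notation W := (monomial I L).

HB.instance Definition _ := Choice.on W.

Definition monomial_mul (x y : W) : W :=
  ([ffun i => x.1 i * y.1 (x.2 i)], x.2 * y.2).
Definition monomial_one : W := ([ffun=> 1], 1).
Definition monomial_inv (x : W) : W :=
  ([ffun i => (x.1 (x.2^-1 i))^-1], x.2^-1).

Lemma monomial_eq (x y : W) : x.1 =1 y.1 -> x.2 = y.2 -> x = y.
Proof. by case: x y => [f s] [g u] /= /ffunP -> ->. Qed.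

Lemma monomial_mulA : associative monomial_mul.
Proof.
move=> x y z; apply: monomial_eq => [i|]; last exact: mulgA.
by rewrite !ffunE /= permM mulgA.
Qed.
Lemma monomial_mul1 : left_id monomial_one monomial_mul.
Proof.
move=> x; apply: monomial_eq => [i|]; last exact: mul1g.
by rewrite !ffunE perm1 mul1g.
Qed.
Lemma monomial_mulr1 : right_id monomial_one monomial_mul.
Proof.
move=> x; apply: monomial_eq => [i|]; last exact: mulg1.
by rewrite !ffunE mulg1.
Qed.
Lemma monomial_mulV : left_inverse monomial_one monomial_inv monomial_mul.
Proof.
move=> x; apply: monomial_eq => [i|]; last exact: mulVg.
by rewrite !ffunE mulVg.
Qed.
Lemma monomial_mulrV : right_inverse monomial_one monomial_inv monomial_mul.
Proof.
move=> x; apply: monomial_eq => [i|]; last exact: mulgV.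
by rewrite !ffunE permK mulgV.
Qed.

HB.instance Definition _ := isGroup.Build W
  monomial_mulA monomial_mul1 monomial_mulr1 monomial_mulV monomial_mulrV.

Lemma monomialM1 (x y : W) i : (x * y).1 i = x.1 i * y.1 (x.2 i).
Proof. by rewrite ffunE. Qed.
Lemma monomialM2 (x y : W) : (x * y).2 = x.2 * y.2. Proof. by []. Qed.
Lemma monomialV1 (x : W) i : x^-1.1 i = (x.1 (x.2^-1 i))^-1.
Proof. by rewrite ffunE. Qed.

End Monomial.

Section CyclicKernel.
Variables (G : groupType) (H : set G) (gT : finGroupType) (chi : G -> gT).
Hypotheses (sH : subgroup H) (chiM : hom_on H chi).

Definition ker_on : set G := H `&` [set x | chi x = 1].

Lemma ker_on_subgroup : subgroup ker_on.
Proof.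
apply: (subgroup_preim sH chiM (B := [set 1])).
by split=> //= x y -> ->; rewrite mulgV.
Qed.

Variables (J : Type) (b : option J -> G).
Hypotheses (basis_b : basis_on H b) (chi_b : forall j, chi (b (Some j)) = 1).

Let t := b None.
Let q := #[chi t].

(** The Schreier generators of the kernel for the transversal [t ^+ k]. *)
Definition ker_basis (i : option ('I_q * J)) : G :=
  if i is Some (k, j) then t ^+ k * b (Some j) * t ^- k else t ^+ q.

Let Ht : H t. Proof. by have [h _ _] := basis_b; exact: h. Qed.
Let HtX k : H (t ^+ k). Proof. exact: subgroupX. Qed.
Let HtV k : H (t ^- k). Proof. exact: subgroupV. Qed.
Let Hb i : H (b i). Proof. by have [h _ _] := basis_b; exact: h. Qed.
Let chi_tX k : chi (t ^+ k) = chi t ^+ k.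
Proof. exact: (morph_onX sH chiM). Qed.

Lemma ker_basis_mem i : ker_on (ker_basis i).
Proof.
case: i => [[k j]|] /=; last by split=> //=; rewrite chi_tX expg_order.
split; first by do 2?apply: subgroupM.
rewrite /= chiM //; last exact: subgroupM.
rewrite chiM // (morph_onV sH chiM) // chi_b mulg1.
by rewrite mulgV.
Qed.

Lemma ker_basis_gen S :
  subgroup S -> (forall i, S (ker_basis i)) -> ker_on `<=` S.
Proof.
move=> sS Sb.
pose K := S `&` ker_on.
have sK : subgroup K by apply: subgroupI => //; exact: ker_on_subgroup.
have Kb i : K (ker_basis i) by split=> //; exact: ker_basis_mem.
have Ktq k : K (t ^+ (q * k)) by rewrite expgM; exact: subgroupX (Kb None).
have Ktd k : q %| k -> K (t ^+ k) by move=> /dvdnP[l ->]; rewrite mulnC.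
(* The largest subgroup of [K] that [t] normalizes.  Conjugation by [t ^+ q]
   preserves [K], so nonnegative powers of [t] suffice. *)
pose N := [set s | forall k : nat, K (t ^+ k * s * t ^- k)].
have NK s : N s -> K s by move=> /(_ 0); rewrite expg0 invg1 mul1g mulg1.
have sN : subgroup N.
  split=> [k|x y Nx Ny k].
    by rewrite mulg1 mulgV; exact: sK.1.
  have := sK.2 _ _ (Nx k) (Ny k).
  by rewrite !invgM invgK !mulgA mulgVK.
have N_b j : N (b (Some j)).
  move=> k; rewrite (divn_eq k q) mulnC expgD.
  have kq : k %% q < q by rewrite ltn_mod order_gt0.
  have := sK.2 _ _ (subgroupM sK (Ktq (k %/ q)) (Kb (Some (Ordinal kq, j))))
    (Ktq (k %/ q)).
  by rewrite /= !invgM !mulgA.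
have N_t s : N (t * s * t^-1) <-> N s.
  split=> Ns k; last first.
    by have := Ns k.+1; rewrite expgSr invgM !mulgA.
  have := Ns (k + q.-1)%N; have q0 : 0 < q := order_gt0 _.
  have e : t ^+ (k + q.-1) * t = t ^+ q * t ^+ k.
    by rewrite -expgSr -expgD -addnS prednK // addnC.
  have -> : t ^+ (k + q.-1) * (t * s * t^-1) * t ^- (k + q.-1) =
      t ^+ q * (t ^+ k * s * t ^- k) * t ^- q.
    by rewrite !mulgA e -[LHS]mulgA -invgM e invgM !mulgA.
  move=> Ks; have := subgroupM sK (subgroupM sK (subgroupV sK (Kb None)) Ks)
    (Kb None).
  by rewrite /= !mulgA mulVg mul1g mulgVK.
have NtX k : q %| k -> N (t ^+ k).
  by move=> qk l; rewrite -expgD addnC expgD mulgK; exact: Ktd.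
(* [H] is the union of the cosets [N t ^- k]. *)
have Nmod x : H x -> exists k, N (x * t ^+ k).
  apply: (basis_on_ind basis_b (P := fun x => exists k, N (x * t ^+ k))).
    by exists 0; rewrite expg0 mulg1; exact: sN.1.
  move=> [j|] y; split=> -[k Nk].
  - exists k; have := subgroupM sN (subgroupV sN (N_b j)) Nk.
    by rewrite -mulgA mulKg.
  - by exists k; rewrite -mulgA; exact: subgroupM sN (N_b j) Nk.
  - exists k.+1; apply/N_t; rewrite expgSr !mulgA.
    by rewrite mulgK.
  - exists (k + q.-1)%N.
    have /N_t : N (y * t ^+ k * t ^+ q) by apply: (subgroupM sN Nk); exact: NtX.
    have -> : t ^+ q = t ^+ q.-1 * t by rewrite -expgSr prednK ?order_gt0.
    by rewrite expgD !mulgA mulgK.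
move=> x [Hx /= chix]; have [k Nk] := Nmod x Hx.
have [Sxk [_ /=]] := NK _ Nk.
rewrite chiM // chix mul1g chi_tX => /eqP; rewrite -order_dvdn => /Ktd[Sk _].
by rewrite -[x](mulgK (t ^+ k)); apply: sS.2.
Qed.

Let rot : {perm 'I_q} := perm (@ordS_inj q).

Let rotX m i : (rot ^+ m) i = (i + m) %% q :> nat.
Proof.
elim: m => [|m IH]; first by rewrite expg0 perm1 addn0 modn_small.
by rewrite expgSr permM permE /= IH -addn1 modnDml addn1 addnS.
Qed.

(** The induced representation: if [phi] maps the kernel [K] to [L], then [H]
    acts on the cosets [K t ^+ k] by monomial matrices over [L], and [phi] is
    the diagonal entry at the coset [K].  The action of the basis elements can
    be written down without knowing [phi]. *)
Lemma ker_basis_ext (L : groupType) (h : option ('I_q * J) -> L) :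
  exists phi : G -> L, hom_on ker_on phi /\ forall i, phi (ker_basis i) = h i.
Proof.
have [_ _ extb] := basis_b.
pose ht : monomial 'I_q L :=
  ([ffun k : 'I_q => if k.+1 == q then h None else 1], rot).
pose hb j : monomial 'I_q L := ([ffun k => h (Some (k, j))], 1).
have [Phi [PhiM Phib]] := extb (monomial 'I_q L)
  (fun i => if i is Some j then hb j else ht).
pose z : 'I_q := Ordinal (order_gt0 (chi t)).
(* [c] generates the graph of the action of [chi x] on the cosets. *)
pose c : gT * {perm 'I_q} := (chi t, rot).
have cX m : c ^+ m = (chi t ^+ m, rot ^+ m).
  by elim: m => // m IH; rewrite !expgS IH.
pose psi x := (chi x, (Phi x).2).
have psiM : hom_on H psi.
  by move=> x y Hx Hy; rewrite /psi chiM // PhiM // monomialM2.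
have psi_mem x : H x -> psi x \in <[c]>.
  apply: (hom_on_mem sH basis_b psiM) => -[j|]; rewrite /psi Phib.
    by rewrite chi_b group1.
  exact: cycle_id.
have Phi_z x : ker_on x -> (Phi x).2 z = z.
  move=> [Hx /= chix]; have /cycleP[m] := psi_mem x Hx.
  rewrite /psi chix cX => -[/esym/eqP m1 ->].
  apply: val_inj; rewrite /= rotX add0n; apply/eqP.
  by rewrite -[_ == _]/(q %| m) order_dvdn.
have PhitX m : Phi (t ^+ m) = ht ^+ m by rewrite (morph_onX sH PhiM) // Phib.
have ht_rot m : (ht ^+ m).2 = rot ^+ m.
  by elim: m => // m IH; rewrite !expgSr monomialM2 IH.
(* Starting from the coset [K], the product of fewer than [q] factors [ht] only meets
   trivial entries; the [q]-th factor meets [h None]. *)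
have ht_z m : m < q -> (ht ^+ m).1 z = 1.
  elim: m => [_|m IH mq]; first by rewrite expg0 ffunE.
  rewrite expgSr monomialM1 IH 1?ltnW // ht_rot ffunE rotX mul1g add0n.
  by rewrite modn_small 1?ltnW // ltn_eqF.
exists (fun x => (Phi x).1 z); split=> [x y Kx Ky|[[k j]|]] /=.
- have [Hx _] := Kx; have [Hy _] := Ky.
  by rewrite PhiM // monomialM1 Phi_z.
- rewrite PhiM //; last exact: subgroupM.
  rewrite PhiM // (morph_onV sH PhiM) // Phib PhitX !monomialM1 monomialV1.
  rewrite monomialM2 mulg1 permK ht_rot ffunE ht_z // mul1g invg1 mulg1.
  congr (h (Some (_, j))); apply: val_inj.
  by rewrite /= rotX add0n modn_small.
- have q_pred : q.-1.+1 = q by rewrite prednK ?order_gt0.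
  have -> : t ^+ q = t ^+ q.-1 * t by rewrite -expgSr q_pred.
  rewrite PhiM // PhitX Phib monomialM1 ht_rot ffunE /= rotX add0n.
  have lt_q : q.-1 < q by rewrite ltn_predL order_gt0.
  by rewrite (ht_z _ lt_q) (modn_small lt_q) q_pred eqxx mul1g.
Qed.

Lemma ker_basisP : basis_on ker_on ker_basis.
Proof.
split; [exact: ker_basis_mem|exact: ker_basis_gen|exact: ker_basis_ext].
Qed.

End CyclicKernel.

(** * Steps of index p *)

(** For [p] prime: [K] is normal of index [p] in [H]. *)
Definition cyclic_step (G : groupType) (p : nat) (H K : set G) : Prop :=
  exists (gT : finGroupType) (chi : G -> gT) (a : gT),
    [/\ hom_on H chi, #[a] = p, forall x, H x -> chi x \in <[a]>,
        exists2 x, H x & chi x <> 1 & K = ker_on H chi].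

Fixpoint step_chain (G : groupType) (p k : nat) (H U : set G) : Prop :=
  if k is k'.+1 then
    exists2 K, cyclic_step p H K & step_chain p k' K U
  else H = U.

Section Steps.
Variables (G : groupType) (p : nat).
Hypothesis p_prime : prime p.
Implicit Types (H K U V : set G) (f : piso p G).

Lemma cyclic_step_open H K : p_open p H -> cyclic_step p H K -> p_open p K.
Proof.
move=> /p_openP[sH kH] [gT [chi [a [chiM oa chia _ ->]]]]; apply/p_openP.
split; first exact: ker_on_subgroup.
apply: p_ker_trans kH _; exists gT, chi, p; split=> //.
- exact: pnat_id.
- move=> x Hx; rewrite (morph_onX sH chiM) // -oa.
  by apply/eqP; rewrite -order_dvdn; exact/order_dvdG/chia.
Qed.

(** Some basis element generates the image of [chi]; dividing the other ones by
    its powers moves them into the kernel. *)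
Lemma cyclic_step_adapted (J : finType) H K (b : option J -> G) :
  subgroup H -> basis_on H b -> cyclic_step p H K ->
  exists (gT : finGroupType) (chi : G -> gT) (c : option J -> G),
    [/\ hom_on H chi, basis_on H c, #[chi (c None)] = p,
        forall j, chi (c (Some j)) = 1 & K = ker_on H chi].
Proof.
move=> sH basis_b [gT [chi [a [chiM oa chia [x Hx chix] ->]]]].
have [i0 chi_i0] : exists i0, chi (b i0) <> 1.
  apply: contrapT => /forallNP chib; apply: chix; apply/set1gP.
  apply: (hom_on_mem (A := 1%G) sH basis_b chiM _ Hx) => i.
  by apply/set1gP; apply: contrapT; exact: chib.
pose s := tperm None i0; pose b' := b \o s.
have basis_b' : basis_on H b'.
  by apply: basis_on_reindex => //; exists (s^-1); [exact: permK|exact: permKV].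
have [Hb' _ _] := basis_b'.
have b'N : b' None = b i0 by rewrite /b' /= tpermL.
have a'a : chi (b' None) \in <[a]> by exact: chia.
have oa' : #[chi (b' None)] = p.
  apply: nt_prime_order => //; last by rewrite b'N; exact/eqP.
  by apply/eqP; rewrite -order_dvdn -oa; exact: order_dvdG.
have cyc_a : <[chi (b' None)]> = <[a]>.
  apply/eqP; rewrite eqEcard cycle_subG a'a /=.
  by rewrite -[leqLHS]/#[a] -[leqRHS]/#[_] oa oa'.
have /choice[m chi_m] : forall j, exists m,
    chi (b' (Some j)) = chi (b' None) ^+ m.
  by move=> j; apply/cycleP; rewrite cyc_a; exact: chia.
have basis_c := basis_on_mulX sH m basis_b'.
exists gT, chi; eexists; split; [exact: chiM|exact: basis_c|exact: oa'| |by []].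
move=> j; have HV := subgroupV sH (Hb' None).
rewrite chiM //; last exact: subgroupX.
by rewrite (morph_onX sH chiM) // (morph_onV sH chiM) // chi_m expVgn mulgV.
Qed.

Lemma cyclic_step_basis (J : finType) H K (b : option J -> G) :
  subgroup H -> basis_on H b -> cyclic_step p H K ->
  exists c : option ('I_p * J) -> G, basis_on K c.
Proof.
move=> sH basis_b /(cyclic_step_adapted sH basis_b).
move=> [gT [chi [c [chiM basis_c <- chic ->]]]].
exists (ker_basis (b := c)); exact: (ker_basisP sH chiM basis_c chic).
Qed.

Lemma cyclic_step_image f H K :
  H `<=` dom f -> cyclic_step p H K -> cyclic_step p (f @` H) (f @` K).
Proof.
move=> Hf [gT [chi [a [chiM oa chia [x Hx chix] ->]]]].
have fK x' : H x' -> inv_fun f (f x') = x' by move=> /Hf; exact: inv_funK.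
exists gT, (chi \o inv_fun f), a; split=> //.
- move=> _ _ [y Hy <-] [z Hz <-] /=.
  by rewrite inv_funM ?fK ?chiM //; exact/pfun_cod/Hf.
- by move=> _ [y Hy <-] /=; rewrite fK // chia.
- by exists (f x); [exists x|rewrite /= fK].
- apply/seteqP; split=> [_ [y [Hy /= chiy] <-]|_ [[y Hy <-] /=]].
    by split; [exists y|rewrite /= fK].
  by rewrite fK // => chiy; exists y.
Qed.

Lemma step_chain_sub k H U : step_chain p k H U -> U `<=` H.
Proof.
elim: k H => [H ->//|k IH H [K [gT [chi [a [_ _ _ _ eK]]]] /IH UK]].
by apply: subset_trans UK _; rewrite eK => x [].
Qed.

Lemma step_chain_image k f H U :
  H `<=` dom f -> step_chain p k H U -> step_chain p k (f @` H) (f @` U).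
Proof.
elim: k H => [H _ -> //|k IH H Hf [K HK KU]].
exists (f @` K); first exact: cyclic_step_image.
apply: IH => // x Kx; apply: Hf.
by apply: (@step_chain_sub 1 H K _ x Kx); exists K.
Qed.

(** The iterated index formula of Schreier.  A basis indexed by [option J] has
    [#|J|] as its rank minus one, which is multiplied by the index in each
    step. *)
Lemma step_chain_basis k (J : finType) H U (b : option J -> G) :
  p_open p H -> basis_on H b -> step_chain p k H U ->
  exists (J' : finType) (c : option J' -> G),
    basis_on U c /\ #|J'| = (p ^ k * #|J|)%N.
Proof.
elim: k J H b => [|k IH] J H b oH basis_b.
  by move=> <-; exists J, b; rewrite mul1n.
move=> [K HK KU]; have [c basis_c] := cyclic_step_basis oH.1 basis_b HK.
have [J' [d [basis_d cJ']]] := IH _ _ _ (cyclic_step_open oH HK) basis_c KU.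
by exists J', d; rewrite cJ' card_prod card_ord expnSr mulnA.
Qed.

(** A proper subgroup of a finite p-group lies in a normal subgroup of index
    [p]. *)
Lemma step_chain_preim (gT : finGroupType) (phi : G -> gT) (A B : {group gT}) :
  hom_on [set: G] phi -> p.-group B -> A \subset B ->
  (forall y, y \in B -> exists x, phi x = y) ->
  exists k, step_chain p k (phi @^-1` [set` B]) (phi @^-1` [set` A]).
Proof.
move=> phiM; have [n] := ubnP #|B|.
elim: n B => // n IH B ltBn pB sAB imB.
have [eAB|[M maxM sAM]] := maximal_exists sAB; first by exists 0; rewrite /= eAB.
have sMB := maxgroupp maxM; have /andP[_ nMB] := p_maximal_normal pB maxM.
have iM := p_maximal_index pB maxM; have {}sMB := proper_sub sMB.
have ltM : #|M| < n.
  by rewrite -ltnS; apply: leq_trans ltBn; exact/proper_card/(maxgroupp maxM).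
have [k chainM] := IH M ltM (pgroupS sMB pB) sAM
  (fun y My => imB y (fintype.subsetP sMB y My)).
exists k.+1, (phi @^-1` [set` M]) => //.
have [y By My] : exists2 y, y \in B & y \notin M.
  by have /properP[_ [y]] := maxgroupp maxM; exists y.
have nM z : z \in B -> z \in 'N(M) by exact: (fintype.subsetP nMB).
have cosetM z : z \in B -> coset M z = 1 -> z \in M.
  by move=> Bz; apply: coset_idr; exact: nM.
have oBM : #|B / M| = p by rewrite card_quotient.
have y1 : coset M y != 1 by apply/eqP => /(cosetM _ By); exact/negP.
have BMy : coset M y \in B / M by exact: mem_quotient.
have oy : #[coset M y] = p.
  apply: nt_prime_order => //.
  by apply/eqP; rewrite -order_dvdn -oBM; exact: order_dvdG.
have cyc_y : <[coset M y]> = B / M.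
  by apply/eqP; rewrite eqEcard cycle_subG BMy oBM -[leqRHS]/#[_] oy /=.
exists (coset_of M), (coset M \o phi), (coset M y); split=> //=.
- by move=> x z /= Bx Bz; rewrite phiM // morphM //=; exact: nM.
- by move=> x /= Bx; rewrite cyc_y; exact: mem_quotient.
- by have [x phix] := imB y By; exists x; rewrite /= phix //; exact/eqP.
- apply/seteqP; split=> x /=; last by move=> [/= Bx] /cosetM; exact.
  by move=> Mx; split=> /=; [exact: (fintype.subsetP sMB)|exact: coset_id].
Qed.

Lemma p_open_step_chain U : p_open p U -> exists k, step_chain p k [set: G] U.
Proof.
move=> /p_openP[sU [gT [phi [m [phiM pm phim kU]]]]].
pose im S := [set s : gT | `[< exists2 x, S x & phi x = s >]]%SET.
have imP S s : reflect (exists2 x, S x & phi x = s) (s \in im S).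
  by rewrite finset.in_set; exact: asboolP.
have im_group S : subgroup S -> group_set (im S).
  move=> sS; apply/group_setP; split.
    apply/imP; exists 1; first exact: sS.1.
    exact: (morph_on1 (subgroupT G) phiM).
  move=> _ _ /imP[x Sx <-] /imP[y Sy <-]; apply/imP.
  by exists (x * y); [exact: subgroupM|exact: phiM].
pose A := Group (im_group U sU); pose B := Group (im_group _ (subgroupT G)).
have inA s : reflect (exists2 x, U x & phi x = s) (s \in A) by exact: imP.
have inB s : reflect (exists2 x, [set: G] x & phi x = s) (s \in B).
  exact: imP.
have sAB : A \subset B.
  by apply/fintype.subsetP => s /inA[x _ <-]; apply/inB; exists x.
have pB : p.-group B.
  apply/pgroupP => q q_prime /(Cauchy q_prime)[s] /inB[x _ <-] oq.
  have /eqP : phi x ^+ m = 1.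
    by rewrite -(morph_onX (subgroupT G) phiM) //; exact: phim.
  rewrite -order_dvdn oq => qm; have /andP[m0 _] := pm.
  by apply: (pnatPpi pm); rewrite mem_primes q_prime m0.
have [] := step_chain_preim phiM pB sAB.
  by move=> y /inB[x _ <-]; exists x.
move=> k; have -> : phi @^-1` [set` B] = [set: G].
  by apply/seteqP; split=> // x _ /=; apply/inB; exists x.
suff -> : phi @^-1` [set` A] = U by exists k.
apply/seteqP; split=> x /=; last by move=> Ux; apply/inA; exists x.
move=> /inA[y Uy e]; rewrite -[x](mulgVK y).
apply: subgroupM => //; apply: kU => //.
rewrite phiM // (morph_onV (subgroupT G) phiM) // e.
by rewrite mulgV.
Qed.

End Steps.

(** * Isomorphisms between subgroups with bases *)

Section BasisIso.
Variables (G : groupType) (p : nat).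
Implicit Types (H K U V : set G) (f g : piso p G).

Lemma basis_on_piso (I : Type) H (b c : I -> G) :
  p_open p H -> basis_on H b -> basis_on H c ->
  exists f, [/\ dom f = H, cod f = H & forall i, f (b i) = c i].
Proof.
move=> oH; have sH := oH.1.
have ext d e : basis_on H d -> basis_on H e -> exists u : G -> G,
    [/\ hom_on H u, forall x, H x -> H (u x) & forall i : I, u (d i) = e i].
  move=> [Hd gend extd] [He _ _]; have [u [uM ude]] := extd G e.
  exists u; split=> //.
  suff HS : H `<=` H `&` u @^-1` H by move=> x /HS[].
  apply: gend => [|i]; first exact: (subgroup_preim sH uM sH).
  by split; rewrite //= ude.
move=> bb bc; have [u [uM uH ub]] := ext _ _ bb bc.
have [v [vM vH vc]] := ext _ _ bc bb.
have compK (d : I -> G) s t : basis_on H d -> hom_on H s -> hom_on H t ->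
    (forall x, H x -> H (s x)) -> (forall i, t (s (d i)) = d i) ->
    forall x, H x -> t (s x) = x.
  move=> bd sM tM sHH std; apply: (eq_hom_on (f := t \o s) sH bd) => //.
  by move=> x y Hx Hy /=; rewrite sM // tM //; exact: sHH.
have uK := compK b u v bb uM vM uH (fun i => etrans (congr1 v (ub i)) (vc i)).
have vK := compK c v u bc vM uM vH (fun i => etrans (congr1 u (vc i)) (ub i)).
have bij_u : set_bij H H u.
  split=> [x|x y /set_mem Hx /set_mem Hy e|y Hy]; first exact: uH.
    by rewrite -[x]uK // e uK.
  by exists (v y); [exact: vH|exact: vK].
by exists (PIso oH oH bij_u uM).
Qed.

(** [Hom(U, Z/2)] has [2 ^ #|I|] elements for a basis of [U] indexed by [I],
    and pulling back along [f] is injective. *)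
Lemma basis_on_card_le (I I' : finType) f (b : I -> G) (c : I' -> G) :
  basis_on (dom f) b -> basis_on (cod f) c -> #|I'| <= #|I|.
Proof.
move=> bb [Hc _ extc]; have sd := p_open_subgroup (dom_open f).
have /choice[E E_P] : forall h : {ffun I' -> 'S_2}, exists u : G -> 'S_2,
    hom_on (cod f) u /\ forall i, u (c i) = h i by move=> h; exact: extc.
pose pull h : {ffun I -> 'S_2} := [ffun i => E h (f (b i))].
have pull_inj : injective pull.
  move=> h h' /ffunP e; apply/ffunP => i'.
  have [EM Eh] := E_P h; have [EM' Eh'] := E_P h'.
  have pM (u : G -> 'S_2) : hom_on (cod f) u -> hom_on (dom f) (u \o f).
    by move=> uM x y dx dy /=; rewrite pfunM // uM //; exact: pfun_cod.
  rewrite -Eh -Eh' -(inv_funKV (Hc i')).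
  apply: (eq_hom_on sd bb (pM _ EM) (pM _ EM') _ (inv_fun_dom (Hc i'))).
  by move=> i; have := e i; rewrite !ffunE.
have := leq_card pull pull_inj.
by rewrite !card_ffun card_Sn leq_exp2l.
Qed.

Lemma basis_on_card (I I' : finType) f (b : I -> G) (c : I' -> G) :
  basis_on (dom f) b -> basis_on (cod f) c -> #|I| = #|I'|.
Proof.
move=> bb bc; apply/eqP; rewrite eqn_leq.
by rewrite (basis_on_card_le bb bc) (@basis_on_card_le _ _ (piso_inv f) c b).
Qed.

Hypothesis p_prime : prime p.

(** The automorphism that maps one adapted basis to the other intertwines [chi]
    and [chi'] up to an isomorphism of the cyclic quotients.  Instead of naming
    that isomorphism, the proof uses its graph: the pairs [(chi x, chi' (f x))]
    lie in the cyclic group generated by the pair of [c None]. *)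
Lemma cyclic_step_trans (J : finType) H K K' (b : option J -> G) :
  p_open p H -> basis_on H b -> cyclic_step p H K -> cyclic_step p H K' ->
  exists f, [/\ dom f = H, cod f = H & f @` K = K'].
Proof.
move=> oH bb HK HK'; have sH := oH.1.
have [gT [chi [c [chiM bc oc chic ->]]]] := cyclic_step_adapted p_prime sH bb HK.
have [gT' [chi' [c' [chiM' bc' oc' chic' ->]]]] :=
  cyclic_step_adapted p_prime sH bb HK'.
have [f [df cf fc]] := basis_on_piso oH bc bc'.
exists f; split=> //.
have fH x : H x -> H (f x) by rewrite -{1}df -cf; exact: pfun_cod.
have fM : hom_on H f by rewrite -df; exact: pfunM.
pose psi x : gT * gT' := (chi x, chi' (f x)).
have psiM : hom_on H psi.
  by move=> x y Hx Hy; rewrite /psi chiM // fM // chiM' //; exact: fH.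
have psi_cyc x : H x -> psi x \in <[psi (c None)]>.
  apply: (hom_on_mem sH bc psiM) => -[j|]; last exact: cycle_id.
  by rewrite /psi fc chic chic'; exact: group1.
have chi_f x : H x -> (chi x = 1 <-> chi' (f x) = 1).
  move=> Hx; have /cycleP[m] := psi_cyc x Hx.
  have -> : psi (c None) ^+ m = (chi (c None) ^+ m, chi' (c' None) ^+ m).
    by rewrite /psi fc; elim: (m) => // l IH; rewrite !expgS IH.
  move=> [-> ->]; split=> /eqP; rewrite -order_dvdn ?oc ?oc' => pm.
    by apply/eqP; rewrite -order_dvdn oc'.
  by apply/eqP; rewrite -order_dvdn oc.
apply/seteqP; split=> [_ [x [Hx /= /chi_f e] <-]|y [Hy /= chiy]].
  by split; [exact: fH|exact: e].
have cy : cod f y by rewrite cf.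
have Hx : H (inv_fun f y) by rewrite -df; exact: inv_fun_dom.
exists (inv_fun f y); last exact: inv_funKV.
by split=> //=; apply/chi_f => //; rewrite inv_funKV.
Qed.

(** * Generation by automorphisms *)

Lemma AComm_subgroup : subgroup (AComm p G).
Proof.
split=> [A [sA _]|x y Ax Ay A cA]; first exact: sA.1.
by have [sA _] := cA; apply: sA.2; [exact: Ax|exact: Ay].
Qed.

Lemma AComm_aut f : dom f = cod f -> AComm p G (piso_class f).
Proof.
move=> e A [_]; apply; exists (dom f); first exact: dom_open.
by exists f.
Qed.

(** The isomorphism is a composition [g \o f] in which the automorphism [f] of
    [H] maps the first step [K] of one chain to the first step [K'] of the other;
    [g] comes from the image under [f] of the rest of the first chain and the
    rest of the second, both of which start at [K']. *)
Lemma AComm_step_chain k (J : finType) H U V (b : option J -> G) :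
  p_open p H -> basis_on H b -> step_chain p k H U -> step_chain p k H V ->
  exists g, [/\ dom g = U, cod g = V & AComm p G (piso_class g)].
Proof.
elim: k J H U V b => [|k IH] J H U V b oH bb /=.
  move=> <- <-; have [g [dg cg _]] := basis_on_piso oH bb bb.
  by exists g; split=> //; apply: AComm_aut; rewrite dg cg.
move=> [K HK KU] [K' HK' KV].
have [f [df cf fK]] := cyclic_step_trans oH bb HK HK'.
have KH : K `<=` dom f.
  by rewrite df => x Kx; apply: (@step_chain_sub _ p 1 H K) => //; exists K.
have UH : U `<=` dom f by move=> x Ux; apply: KH; exact: step_chain_sub KU x Ux.
have fKU := step_chain_image KH KU; rewrite fK in fKU.
have [c bc] := cyclic_step_basis p_prime oH.1 bb HK'.
have [g [dg cg gA]] := IH _ _ _ _ _ (cyclic_step_open p_prime oH HK') bc fKU KV.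
exists (piso_comp g f); split.
- apply/seteqP; split=> [x [dx [_ /=]]|x Ux].
    rewrite dg => -[u Uu e].
    by rewrite -(pfun_inj (UH u Uu) dx e).
  split; first exact: UH.
  split; first exact/pfun_cod/UH.
  by rewrite dg; exists x.
- rewrite /= /comp_cod -cg.
  have [gS _ gJ] := pfun_bij g.
  apply/seteqP; split=> [_ [x [_ dx] <-]|y /gJ[x dx <-]]; first exact: gS.
  exists x => //; split=> //; move: dx; rewrite dg => -[u Uu <-].
  exact/pfun_cod/UH.
- have fA : AComm p G (piso_class f) by apply: AComm_aut; rewrite df cf.
  by rewrite -piso_classM; exact: subgroupM AComm_subgroup gA fA.
Qed.

End BasisIso.

Lemma basis_on_abelian (G : groupType) (I : Type) (b : I -> G) :
  basis_on [set: G] b -> (forall i j, b i = b j) -> abelian_group G.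
Proof.
move=> [_ gen _] eb.
have sC (y : G) : subgroup [set x | commute y x].
  split=> [|x z cx cz]; first exact: commute1.
  by apply: commuteM => //; exact: commuteV.
have bC i : [set: G] `<=` [set x | commute (b i) x].
  by apply: gen => // j; rewrite /= (eb j i); exact: commute_refl.
suff xC x : [set: G] `<=` [set y | commute x y] by move=> x y; exact: xC.
by apply: gen => // i; exact/commute_sym/bC.
Qed.

Lemma free_nonabelian_basis (F : groupType) :
  free_of_finite_rank F -> ~ abelian_group F ->
  exists (J : finType) (b : option J -> F), basis_on [set: F] b /\ 0 < #|J|.
Proof.
move=> [[|n] [b /free_basis_on bb]] nab.
  by case: nab; apply: (basis_on_abelian bb) => -[].
exists 'I_n, (b \o (fun i => if i is Some j then lift ord0 j else ord0)).
split.
  apply: basis_on_reindex bb; exists (unlift ord0) => [[j|]|i].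
  - exact: liftK.
  - exact: unlift_none.
  - by case: unliftP.
rewrite card_ord lt0n; apply/eqP => n0; apply: nab.
by apply: (basis_on_abelian bb) => i j; congr b; apply: val_inj; move: i j;
  rewrite n0 => i j; rewrite !ord1.
Qed.

Theorem corollary7p3 (p : nat) (F : groupType)
    (p_prime : prime p)
    (F_free : free_of_finite_rank F)
    (F_nonabelian : ~ abelian_group F) :
  AComm p F = [set: Comm p F].
Proof.
have [J [b [bb J_gt0]]] := free_nonabelian_basis F_free F_nonabelian.
have oF := p_openT F p.
apply/seteqP; split=> // a _; elim/comm_ind: a => f.
have [k chainU] := p_open_step_chain p_prime (dom_open f).
have [l chainV] := p_open_step_chain p_prime (cod_open f).
have [JU [bU [bbU cardU]]] := step_chain_basis p_prime oF bb chainU.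
have [JV [bV [bbV cardV]]] := step_chain_basis p_prime oF bb chainV.
(* The ranks are [p ^ k * #|J| + 1] and [p ^ l * #|J| + 1]. *)
have kl : k = l.
  have := basis_on_card bbU bbV; rewrite !card_option cardU cardV => -[] /eqP.
  by rewrite eqn_pmul2r // eqn_exp2l ?prime_gt1 // => /eqP.
rewrite -kl in chainV.
have [g [dg cg gA]] := AComm_step_chain p_prime oF bb chainU chainV.
have hA : AComm p F (piso_class (piso_comp (piso_inv g) f)).
  have [_ _ gJ] := inv_bij g; apply: AComm_aut.
  have -> : dom (piso_comp (piso_inv g) f) = dom f.
    apply/seteqP; split=> [x []|x dx] //; split=> //.
    by rewrite /= cg; split; exact: pfun_cod.
  rewrite /= /comp_cod /= cg setIid -cg -dg.
  by apply/seteqP; split=> [x /gJ|_ [y cy <-]] //; exact: inv_fun_dom.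
have gh : piso_class g * piso_class (piso_comp (piso_inv g) f) = piso_class f.
  by rewrite -piso_classM -piso_classV mulKVg.
by rewrite -gh; exact: subgroupM (AComm_subgroup _ _) gA hA.
Qed.
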